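(* Let $d\ge 1$, let $S\in\mathbb{R}^{d\times d}$ be a constant skew-symmetric matrix, let $H:\mathbb{R}^d\to\mathbb{R}$ be a homogeneous cubic polynomial, and let $\Delta t>0$. Consider the ODE $\dot x=f(x)=S\nabla H(x)$. Consider the two-step scheme obtained from the general family $$\frac{x^{n+2}-x^n}{2\Delta t}=S\sum_{i,j=1}^3\alpha_{ij}\bigl(H''(x^{n-1+i})x^{n-1+j}+\beta(x^{n-1+i})\bigr)$$ by taking $\alpha_{21}=\alpha_{23}=\tfrac14$ and $\alpha_{ij}=0$ otherwise, i.e. $$\frac{x^{n+2}-x^n}{2\Delta t}=\frac14\,S\,H''(x^{n+1})(x^n+x^{n+2}),\qquad (\ast)$$ where $x^1$ is found from $x^0$ by Kahan's method. Then this scheme is equivalent to Kahan's method over two consecutive steps. That is: for every $N\ge 2$ and all points $x^0,x^1,\dots,x^N\in\mathbb{R}^d$ such that $x^1$ is obtained from $x^0$ by one step of Kahan's method, relation $(\ast)$ holds for all $0\le n\le N-2$ if and only if $x^{n+1}$ is obtained from $x^n$ by one step of Kahan's method for all $0\le n\le N-1$.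
   Context: $H''(x)\in\mathbb{R}^{d\times d}$ denotes the Hessian matrix of $H$ at $x$, and $\beta(x):=2\nabla H(x)-H''(x)x$ (which vanishes identically when $H$ is a homogeneous cubic). Kahan's method with step size $\Delta t$ for an ODE $\dot x=f(x)$ with $f$ a quadratic polynomial vector field: $x^{n+1}$ is obtained from $x^n$ by one step of Kahan's method if $$\frac{x^{n+1}-x^n}{\Delta t}=-\frac12 f(x^n)+2f\Bigl(\frac{x^n+x^{n+1}}{2}\Bigr)-\frac12 f(x^{n+1}).$$ Superscripts on $x$ are time-step indices. *)

(* Defs.v *)
From HB Require Import structures.
From mathcomp Require Import all_boot all_order all_algebra.
From mathcomp Require Import reals.
From mathcomp Require Import mpoly.

Set Implicit Arguments.
Unset Strict Implicit.
Unset Printing Implicit Defensive.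

Import Order.TTheory GRing.Theory Num.Theory.

Local Open Scope ring_scope.

Section KahanDefs.
Variables (R : realType) (d : nat).
Implicit Types (S : 'M[R]_d) (H : {mpoly R[d]}) (v : 'cV[R]_d).
Implicit Types (x : nat -> 'cV[R]_d) (dt : R).

Definition mpeval (p : {mpoly R[d]}) v : R := p.@[fun i => v i 0].

Definition grad H v : 'cV[R]_d := \col_i mpeval H^`M(i) v.

Definition hess H v : 'M[R]_d := \matrix_(i, j) mpeval H^`M(i)^`M(j) v.

Definition beta H v : 'cV[R]_d := 2 *: grad H v - hess H v *m v.

(* Used for quadratic polynomial vector fields f; the formula itself makes
   sense for any f. *)
Definition kahan_step (f : 'cV[R]_d -> 'cV[R]_d) dt (u v : 'cV[R]_d) : Prop :=
  dt^-1 *: (v - u)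
    = - (2^-1 *: f u) + 2 *: f (2^-1 *: (u + v)) - 2^-1 *: f v.

(* Indices i, j run over {0, 1, 2} instead of {1, 2, 3}, so that the point
   x^{n-1+i} of the usual presentation is x (n + i) here. *)
Definition two_step S H (alpha : 'M[R]_3) dt x (n : nat) : Prop :=
  (2 * dt)^-1 *: (x n.+2 - x n)
    = S *m \sum_(i < 3) \sum_(j < 3)
        alpha i j *: (hess H (x (n + i)%N) *m x (n + j)%N
                      + beta H (x (n + i)%N)).

(* alpha_21 = alpha_23 = 1/4 in one-based indexing, all other entries 0. *)
Definition alpha_kahan : 'M[R]_3 :=
  \matrix_(i, j)
    if (i == 1%N :> nat) && ((j == 0%N :> nat) || (j == 2%N :> nat))
    then 4^-1 else 0.

Definition kahan_two_step S H dt x (n : nat) : Prop :=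
  (2 * dt)^-1 *: (x n.+2 - x n)
    = 4^-1 *: (S *m hess H (x n.+1) *m (x n + x n.+2)).

End KahanDefs.

Arguments alpha_kahan {R}.

(* Main.v *)
(** For a homogeneous cubic [H], [B u v := H''(u) v] is bilinear and symmetric
    and [grad H u = B u u / 2], so polarization turns Kahan's step into
    [(v - u) / dt = S (B u v) / 2].  The two-step relation is the average of
    two consecutive relations of this form; hence each Kahan step together with
    the two-step relation yields the next Kahan step. *)

Require Import Defs.
From HB Require Import structures.
From mathcomp Require Import all_boot all_order all_algebra.
From mathcomp Require Import reals.
From mathcomp Require Import mpoly.
From mathcomp Require Import ring lra zify.

Set Implicit Arguments.
Unset Strict Implicit.
Unset Printing Implicit Defensive.

Import Order.TTheory GRing.Theory Num.Theory.

Local Open Scope ring_scope.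

Lemma dhomog_mderiv (n k : nat) (R : comNzRingType) (p : {mpoly R[n]}) i :
  p \is k.+1.-homog -> p^`M(i) \is k.-homog.
Proof.
move=> /dhomogP hp; apply/dhomogP => m; rewrite mcoeff_msupp mcoeff_mderiv.
move=> hm; have /hp : (m + U_(i))%MM \in msupp p.
  by rewrite mcoeff_msupp; apply: contraNneq hm => ->; rewrite mul0rn.
by rewrite /= mdegD mdeg1 addn1 => -[].
Qed.

(** Checked monomial by monomial: differentiating in variable [i] and multiplying back by ['X_i]
    scales ['X_[m]] by [m i], and the exponents add up to the degree [k]. *)
Lemma euler_dhomog (n k : nat) (R : comNzRingType) (p : {mpoly R[n]}) :
  p \is k.-homog -> \sum_i 'X_i * p^`M(i) = p *+ k.
Proof.
move=> /dhomogP hp.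
rewrite [p in RHS]mpolyE -sumrMnl.
under eq_bigr => i _ do rewrite {1}[p]mpolyE raddf_sum mulr_sumr.
rewrite exchange_big /= !big_seq; apply: eq_bigr => m /hp <-.
rewrite [mf in (_ *+ mf)]mdegE -sumrMnr; apply: eq_bigr => i _.
rewrite mderivZ mderivX -!scalerAr -mpolyXD scaler_nat -scalerMnr.
(* Exponent subtraction is truncated, so [U_(i)] can be added back only if [m i] is positive;
   otherwise both sides vanish. *)
have [-> | mi_gt0] := posnP (m i); first by rewrite !mulr0n.
congr (_ *: 'X_[_] *+ _); apply/mnmP => j.
by rewrite mnmDE mnmBE mnm1E; case: eqP => [<-|_]; rewrite ?subnKC ?subn0.
Qed.

Section HomogeneousCubic.
Variables (R : realType) (d : nat) (H : {mpoly R[d]}).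
Hypothesis hH : H \is 3.-homog.
Implicit Types u v w : 'cV[R]_d.

Lemma mpeval_euler (p : {mpoly R[d]}) k v :
  p \is k.-homog -> \sum_i v i 0 * mpeval p^`M(i) v = mpeval p v *+ k.
Proof.
move=> /euler_dhomog hp; rewrite /mpeval -mevalMn -hp raddf_sum /=.
by apply: eq_bigr => i _; rewrite mevalM mevalXU.
Qed.

(** Euler's identity for each partial derivative of [H], homogeneous of degree 2. *)
Lemma grad_hess v : hess H v *m v = 2 *: grad H v.
Proof.
apply/matrixP => i j; rewrite ord1 !mxE.
rewrite mulr_natl -(mpeval_euler v (dhomog_mderiv i hH)).
by apply: eq_bigr => k _; rewrite !mxE mulrC.
Qed.

Lemma beta_cubic v : beta H v = 0.
Proof. by rewrite /beta grad_hess subrr. Qed.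

(** Euler's identity in degree 1; the third derivatives are constants, recorded as their
    coefficients at [0]. *)
Lemma hess_entry v i j :
  hess H v i j = \sum_k v k 0 * H^`M(i)^`M(j)^`M(k)@_0.
Proof.
have h1 := dhomog_mderiv j (dhomog_mderiv i hH).
rewrite mxE -[LHS]mulr1n -(mpeval_euler v h1); apply: eq_bigr => k _.
have /dhomogP h0 := dhomog_mderiv k h1.
congr (_ * _); rewrite /mpeval [X in X.@[_]]msize1_polyC ?mevalC //.
by rewrite msizeE; apply/bigmax_leqP_seq => m /h0 /= ->.
Qed.

(** Both sides contract the tensor of third derivatives with [u] and [v]; they agree because its
    last two indices commute. *)
Lemma hess_sym u v : hess H u *m v = hess H v *m u.
Proof.
apply/matrixP => i j; rewrite ord1 !mxE.
under eq_bigr => k _ do rewrite hess_entry mulr_suml.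
under [RHS]eq_bigr => k _ do rewrite hess_entry mulr_suml.
rewrite exchange_big; apply: eq_bigr => k _; apply: eq_bigr => l _ /=.
by rewrite (mderiv_comm l k) mulrC mulrA mulrAC.
Qed.

Lemma gradE v : grad H v = 2^-1 *: (hess H v *m v).
Proof. by rewrite grad_hess scalerA mulVf ?scale1r ?pnatr_eq0. Qed.

Lemma kahan_step_cubic (S : 'M[R]_d) dt u v :
  kahan_step (fun w => S *m grad H w) dt u v <->
  dt^-1 *: (v - u) = 2^-1 *: (S *m hess H u *m v).
Proof.
rewrite /kahan_step !gradE.
have -> : hess H (2^-1 *: (u + v)) *m (2^-1 *: (u + v)) =
    4^-1 *: (hess H u *m u + 2 *: (hess H u *m v) + hess H v *m v).
  (* Symmetry moves the midpoint from the Hessian's argument to the vector side, where linearity is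
     available. *)
  rewrite -scalemxAr mulmxDr 2!(hess_sym (2^-1 *: _)) -!scalemxAr !mulmxDr.
  rewrite (hess_sym v u); apply/matrixP => i j; rewrite !mxE.
  by field.
rewrite -mulmxA -!scalemxAr !mulmxDr -!scalemxAr.
set E := RHS; set F := (X in _ <-> _ = X).
suff -> : E = F by [].
(* The diagonal terms cancel, their weights being -1/4 from an endpoint and +1/4 from the midpoint;
   the mixed term keeps weight 1/2. *)
by rewrite /E /F; apply/matrixP => i j; rewrite !mxE; field.
Qed.

Lemma two_step_alpha_kahan (S : 'M[R]_d) dt x n :
  two_step S H alpha_kahan dt x n <-> kahan_two_step S H dt x n.
Proof.
rewrite /two_step /kahan_two_step !big_ord_recl !big_ord0 !mxE /=.
rewrite !beta_cubic !addr0 !scale0r !add0r !addr0.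
by rewrite addn0 addn1 addn2 -scalerDr -mulmxDr -scalemxAr mulmxA.
Qed.

Lemma kahan_two_step_next (S : 'M[R]_d) dt x n :
  kahan_step (fun w => S *m grad H w) dt (x n) (x n.+1) ->
  kahan_two_step S H dt x n <->
  kahan_step (fun w => S *m grad H w) dt (x n.+1) (x n.+2).
Proof.
rewrite !kahan_step_cubic /kahan_two_step mulmxDr -!mulmxA.
(* After this swap the first Kahan step and the two-step relation share the same product, so
   entrywise each claim is a linear combination of the two hypotheses. *)
rewrite (hess_sym (x n)) invfM.
move: (S *m _) (S *m _) => a b.
move=> /matrixP h0; split=> /matrixP h; apply/matrixP => i j;
  by move: (h0 i j) (h i j); rewrite !mxE; move: (dt^-1) => c; lra.
Qed.

End HomogeneousCubic.

Theorem theorem1 (R : realType) (d : nat) (hd : (1 <= d)%N)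
    (S : 'M[R]_d) (hS : S^T = - S)
    (H : {mpoly R[d]}) (hH : H \is 3.-homog)
    (dt : R) (hdt : 0 < dt) :
  let f := fun v : 'cV[R]_d => S *m grad H v in
  (forall (x : nat -> 'cV[R]_d) (n : nat),
     two_step S H alpha_kahan dt x n <-> kahan_two_step S H dt x n)
  /\
  (forall (N : nat) (x : nat -> 'cV[R]_d),
     (2 <= N)%N ->
     kahan_step f dt (x 0%N) (x 1%N) ->
     ((forall n : nat, (n <= N - 2)%N -> kahan_two_step S H dt x n)
      <->
      (forall n : nat, (n <= N - 1)%N -> kahan_step f dt (x n) (x n.+1)))).
Proof.
move=> f; split=> [x n|N x hN x01]; first exact: two_step_alpha_kahan.
split=> [two_steps | steps n hn]; last first.
  by apply/(kahan_two_step_next hH); apply: steps; lia.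
(* The base case is the Kahan starting step [x01]; the two-step relation at [n] then carries step
   [n] to step [n.+1]. *)
elim=> [//|n IHn] hn.
by apply/(kahan_two_step_next hH); [apply: IHn | apply: two_steps]; lia.
Qed.
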